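(* Let $X=\{\frac{1}{n}:n\in\mathbb Z\setminus\{0\}\}\cup\{0\}$ with the metric $d$ induced from the Euclidean line $\mathbb R$, and define $f:X\to X$ by $f(x)=\frac{1}{n-2}$ if $x=\frac1n$ for some odd integer $n$ (positive or negative), and $f(x)=-x$ otherwise. Let $\mathcal I=\mathcal P(2\mathbb Z+1)$, the ideal on $\mathbb Z$ of all subsets of the set of odd integers. Then the transformation group $(\mathbb Z,X,\varrho_f)$, where $\varrho_f(n,x)=f^n(x)$ for $n\in\mathbb Z$, $x\in X$, does not have the shadowing property, but it has the $\mathcal I$-shadowing property.
   Context: $X$ carries the metric uniform structure $\mathcal K$ consisting of all $\alpha\subseteq X\times X$ that contain $\{(x,y):d(x,y)<\varepsilon\}$ for some $\varepsilon>0$. An ideal on a set $T$ is a nonempty collection of subsets of $T$ closed under finite unions and under taking subsets. Let a discrete semigroup $T$ with identity act continuously on a uniform space $(X,\mathcal K)$, $(t,x)\mapsto tx$ (here $T=(\mathbb Z,+)$, $nx=f^n(x)$). For a family $(x_t)_{t\in T}$ in $X$, $\theta\in\mathcal K$ and a nonempty $A\subseteq T$: $(x_t)_{t\in T}$ is a $\theta$-pseudo orbit with respect to $A$ if $(ax_t,x_{at})\in\theta$ for all $a\in A$, $t\in T$ (here $at$ means $a+t$); $x\in X$ is a $\theta$-trace of $(x_t)_{t\in T}$ if $(tx,x_t)\in\theta$ for all $t\in T$. $(T,X)$ has the shadowing property with respect to $A$ if for each $\alpha\in\mathcal K$ there is $\beta\in\mathcal K$ such that every $\beta$-pseudo orbit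 with respect to $A$ has an $\alpha$-trace. For an ideal $\mathcal J$ on $T$, $(T,X)$ has the $\mathcal J$-shadowing property if there is a nonempty $A\in\mathcal J$ such that $(T,X)$ has the shadowing property with respect to $A$. $(T,X)$ has the shadowing property if it has the $\mathcal P_{fin}(T)$-shadowing property, where $\mathcal P_{fin}(T)$ is the ideal of finite subsets of $T$. *)

(* Defs.v *)
From HB Require Import structures.
From mathcomp Require Import all_boot all_order all_algebra.
From mathcomp Require Import all_classical all_reals all_analysis.
From mathcomp Require Import zify ring lra.

Set Implicit Arguments.
Unset Strict Implicit.
Unset Printing Implicit Defensive.

Import Order.TTheory GRing.Theory Num.Theory.
Import numFieldNormedType.Exports.

Local Open Scope classical_set_scope.
Local Open Scope ring_scope.

Record ideal (T : Type) := Ideal {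
  ideal_mem :> set T -> Prop;
  ideal_nonempty : exists A, ideal_mem A;
  idealU : forall A B, ideal_mem A -> ideal_mem B -> ideal_mem (A `|` B);
  idealS : forall A B, A `<=` B -> ideal_mem B -> ideal_mem A }.

Program Definition fin_ideal (T : Type) : ideal T :=
  @Ideal T [set A | finite_set A] _ _ _.
Next Obligation. by move=> T; exists set0; exact: finite_set0. Qed.
Next Obligation. by move=> T A B Af Bf /=; rewrite finite_setU; split. Qed.
Next Obligation. by move=> T A B AB; exact: sub_finite_set. Qed.

Program Definition powerset_ideal (T : Type) (S : set T) : ideal T :=
  @Ideal T [set A | A `<=` S] _ _ _.
Next Obligation. by move=> T S; exists set0; exact: sub0set. Qed.
Next Obligation. by move=> T S A B AS BS x [/AS|/BS]. Qed.
Next Obligation. by move=> T S A B AB BS; exact: subset_trans AB BS. Qed.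

(* The acting semigroup is discrete, so joint continuity of the action means
   continuity of each translation. It is written additively; [nmodType] also
   makes it commutative, which is all that the group of integers needs. *)
Record action (T : nmodType) (X : uniformType) := Action {
  act :> T -> X -> X;
  act0 : forall x, act 0 x = x;
  actD : forall s t x, act (s + t) x = act s (act t x);
  act_continuous : forall t, continuous (act t) }.

Section Shadowing.
Variables (T : nmodType) (X : uniformType) (rho : action T X).

Definition pseudo_orbit (theta : set (X * X)) (A : set T) (x : T -> X) :=
  forall a t, A a -> theta (rho a (x t), x (a + t)).

Definition trace (theta : set (X * X)) (x : T -> X) (z : X) :=
  forall t, theta (rho t z, x t).

Definition shadowing_wrt (A : set T) :=
  forall alpha : set (X * X), entourage alpha ->
  exists2 beta : set (X * X), entourage beta &
  forall x : T -> X, pseudo_orbit beta A x -> exists z, trace alpha x z.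

Definition ideal_shadowing (J : ideal T) :=
  exists A : set T, [/\ A !=set0, J A & shadowing_wrt A].

Definition shadowing := ideal_shadowing (fin_ideal T).

End Shadowing.

Record homeomorphism (X : uniformType) := Homeomorphism {
  homeo_fun :> X -> X;
  homeo_inv : X -> X;
  homeo_funK : cancel homeo_fun homeo_inv;
  homeo_invK : cancel homeo_inv homeo_fun;
  homeo_fun_continuous : continuous homeo_fun;
  homeo_inv_continuous : continuous homeo_inv }.

Section IterateAction.
Variables (X : uniformType) (h : homeomorphism X).

(* [Negz k] is - k.+1 *)
Definition iterz (n : int) (x : X) : X :=
  match n with
  | Posz k => iter k h x
  | Negz k => iter k.+1 (homeo_inv h) x
  end.

Lemma iterzS n x : iterz (n + 1) x = h (iterz n x).
Proof.
case: n => [k|k]; first by rewrite addrC -PoszD.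
rewrite NegzE /= homeo_invK; case: k => [|k] //.
by have -> : - (k.+2%:Z) + 1 = Negz k by lia.
Qed.

Lemma iterzP n x : iterz (n - 1) x = homeo_inv h (iterz n x).
Proof. by rewrite -{2}(subrK 1 n) iterzS homeo_funK. Qed.

Lemma iterzD m n x : iterz (m + n) x = iterz m (iterz n x).
Proof.
elim/int_ind: m => [|m IH|m IH]; first by rewrite add0r.
- have -> : m.+1%:Z + n = (m%:Z + n) + 1 by lia.
  have -> : m.+1%:Z = m%:Z + 1 by lia.
  by rewrite !iterzS IH.
- have -> : - m.+1%:Z + n = (- m%:Z + n) - 1 by lia.
  have -> : - m.+1%:Z = - m%:Z - 1 by lia.
  by rewrite !iterzP IH.
Qed.

Lemma iterz_continuous n : continuous (iterz n).
Proof.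
have itc (g : X -> X) k : continuous g -> continuous (iter k g).
  move=> gc; elim: k => [|k IH] x /=; first exact: cvg_id.
  by apply: (@continuous_comp _ _ _ (iter k g) g); [exact: IH | exact: gc].
case: n => k x.
- exact: (itc h k (@homeo_fun_continuous _ h) x).
- exact: (itc (homeo_inv h) k.+1 (@homeo_inv_continuous _ h) x).
Qed.

Definition iterate_action : action int X :=
  @Action int X iterz (fun=> erefl) iterzD iterz_continuous.

End IterateAction.

Definition odd_ints : set int := [set 2 * k + 1 | k in [set: int]].

Section Example.
Variable R : realType.

Definition harmonic_set : set R :=
  [set n%:~R^-1 | n in [set n : int | n != 0]] `|` [set 0].

(* [set_type] carries the uniform structure induced from R *)
Definition harmonic_space : uniformType := set_type harmonic_set.

Lemma harmonic_entourageE (alpha : set (harmonic_space * harmonic_space)) :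
  entourage alpha <->
  exists2 e : R, 0 < e &
    [set xy | `|set_val xy.1 - set_val xy.2| < e] `<=` alpha.
Proof.
split.
- move=> [B]; rewrite -entourage_ballE => -[e /= e0 eB] Ba.
  by exists e => // xy xye; apply: Ba; apply: eB.
- move=> [e e0 ea]; exists [set xy : R * R | ball xy.1 e xy.2].
    by rewrite -entourage_ballE; exists e.
  by move=> xy xye; apply: ea.
Qed.

(* x |-> 1 / (n - 2) when x = 1 / n for an odd integer n (such n is unique),
   and x |-> - x otherwise *)
Definition harmonic_real (x : R) : R :=
  if pselect (exists2 n : int, odd_ints n & x = n%:~R^-1) is left h
  then (s2val (cid2 h) - 2)%:~R^-1 else - x.

Lemma odd_ints_neq0 n : odd_ints n -> n != 0.
Proof. by move=> [k _ <-]; lia. Qed.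

Lemma odd_intsB2 n : odd_ints n -> odd_ints (n - 2).
Proof. by move=> [k _ <-]; exists (k - 1) => //; lia. Qed.

Lemma odd_intsN n : odd_ints n -> odd_ints (- n).
Proof. by move=> [k _ <-]; exists (- k - 1) => //; lia. Qed.

Lemma harmonic_real_odd n : odd_ints n ->
  harmonic_real n%:~R^-1 = (n - 2)%:~R^-1.
Proof.
move=> on; rewrite /harmonic_real; case: pselect => [h|[]]; last by exists n.
by case: cid2 => m /= _ /invr_inj/intr_inj ->.
Qed.

Lemma harmonic_real_even x : ~ (exists2 n, odd_ints n & x = n%:~R^-1) ->
  harmonic_real x = - x.
Proof. by rewrite /harmonic_real; case: pselect. Qed.

Lemma harmonic_setN x : harmonic_set x -> harmonic_set (- x).
Proof.
case=> [[n /= n0 <-]|->]; last by right; rewrite oppr0.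
by left; exists (- n) => /=; rewrite ?oppr_eq0 // mulrNz invrN.
Qed.

Lemma harmonic_real_set x : harmonic_set x -> harmonic_set (harmonic_real x).
Proof.
move=> Xx; have [[n on ->]|nx] := pselect (exists2 n, odd_ints n & x = n%:~R^-1).
- rewrite harmonic_real_odd //; left; exists (n - 2) => //=.
  exact/odd_ints_neq0/odd_intsB2.
- by rewrite harmonic_real_even //; exact: harmonic_setN.
Qed.

Lemma harmonic_realNK x : harmonic_real (- harmonic_real x) = - x.
Proof.
have [[n on ->]|nx] := pselect (exists2 n, odd_ints n & x = n%:~R^-1).
- rewrite harmonic_real_odd // -invrN -mulrNz harmonic_real_odd; last first.
    exact/odd_intsN/odd_intsB2.
  rewrite -(invrN (n%:~R : R)) -(mulrNz (1 : R) n).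
  by congr ((_%:~R)^-1); lia.
- by rewrite (harmonic_real_even nx) opprK harmonic_real_even.
Qed.

Lemma harmonic_real_le x : `|harmonic_real x| <= 3 * `|x|.
Proof.
have [[n on ->]|nx] := pselect (exists2 n, odd_ints n & x = n%:~R^-1).
- rewrite harmonic_real_odd // !normfV -!intr_norm.
  have n0 : (0 < `|n|)%R by rewrite normr_gt0 odd_ints_neq0.
  have m0 : (0 < `|n - 2|)%R by rewrite normr_gt0 odd_ints_neq0 //; exact: odd_intsB2.
  rewrite ler_pdivlMr ?ltr0z // mulrC ler_pdivrMr ?ltr0z //.
  rewrite -[3]/(3%:~R) -intrM ler_int.
  by move: on => [k _ <-]; lia.
- by rewrite harmonic_real_even // normrN ler_peMl //; lra.
Qed.

Lemma harmonic_set_isolated x y : harmonic_set x -> harmonic_set y ->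
  x != 0 -> `|x - y| < x ^+ 2 / 2 -> x = y.
Proof.
move=> [[n /= n0 <-]|->]; last by rewrite eqxx.
move=> Xy _.
have hn : (n%:~R : R) != 0 by rewrite intr_eq0.
have n1 : 1 <= `|n%:~R : R| by rewrite -intr_norm -[1]/(1%:~R) ler_int; lia.
set u : R := n%:~R^-1.
have u1 : 0 < `|u| <= 1.
  by rewrite normr_gt0 invr_eq0 hn /= normfV invf_le1 // (lt_le_trans _ n1).
have u2 : u ^+ 2 = `|u| ^+ 2 by rewrite real_normK ?num_real.
case: Xy => [[m /= m0 <-]|->]; last by rewrite subr0 u2; nra.
have hm : (m%:~R : R) != 0 by rewrite intr_eq0.
have [nm|nm] := eqVneq n m; first by rewrite /u nm.
have -> : u - m%:~R^-1 = u * m%:~R^-1 * (m - n)%:~R.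
  by rewrite /u intrB; field; rewrite hn hm.
set v : R := m%:~R^-1.
have d1 : 1 <= `|(m - n)%:~R : R|.
  by rewrite -intr_norm -[1]/(1%:~R) ler_int; lia.
have -> : u * v * (m - n)%:~R = u - v.
  by rewrite /u /v intrB; field; rewrite hn hm.
move=> uv.
have e : `|u - v| = `|u| * `|v| * `|(m - n)%:~R : R|.
  by rewrite -!normrM; congr `| _ |; rewrite /u /v intrB; field; rewrite hn hm.
have := ler_distD v u 0; rewrite !subr0 => tri.
have v0 := normr_ge0 v.
have : `|u| * `|v| <= `|u - v| by rewrite e ler_peMr // mulr_ge0.
by move: uv; rewrite u2; nra.
Qed.

Definition harmonic_opp (x : harmonic_space) : harmonic_space :=
  SigSub (mem_set (harmonic_setN (set_valP x))).

Definition harmonic_map (x : harmonic_space) : harmonic_space :=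
  SigSub (mem_set (harmonic_real_set (set_valP x))).

(* Conjugating by x |-> - x turns the shift n - 2 into n + 2. *)
Definition harmonic_map_inv (x : harmonic_space) : harmonic_space :=
  harmonic_opp (harmonic_map (harmonic_opp x)).

Lemma harmonic_mapK : cancel harmonic_map harmonic_map_inv.
Proof. by move=> x; apply: val_inj => /=; rewrite harmonic_realNK opprK. Qed.

Lemma harmonic_map_invK : cancel harmonic_map_inv harmonic_map.
Proof. by move=> x; apply: val_inj => /=; rewrite harmonic_realNK opprK. Qed.

Lemma harmonic_continuous (g : harmonic_space -> harmonic_space) (c : R) :
  0 < c -> (forall x, `|set_val (g x)| <= c * `|set_val x|) -> continuous g.
Proof.
move=> c0 gc x.
have FF : Filter (g @ x) by apply: fmap_filter; exact: nbhs_filter.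
apply/cvg_entourageP => A /harmonic_entourageE[e e0 eA].
suff [d d0 xd] : exists2 d, 0 < d & forall y : harmonic_space,
    `|set_val x - set_val y| < d -> `|set_val (g x) - set_val (g y)| < e.
  have : nbhs x (xsection [set xy : harmonic_space * harmonic_space |
      `|set_val xy.1 - set_val xy.2| < d] x).
    by apply: nbhs_entourage; apply/harmonic_entourageE; exists d.
  by apply: filterS => y /set_mem xy; apply: eA; exact: xd.
have [x0|x0] := eqVneq (set_val x) 0.
- have gx0 : set_val (g x) = 0.
    apply/normr0_eq0/le_anti.
    by rewrite normr_ge0 (le_trans (gc x)) // x0 normr0 mulr0.
  exists (e / c); first exact: divr_gt0.
  move=> y; rewrite x0 gx0 !sub0r !normrN ltr_pdivlMr // mulrC => xy.
  exact: le_lt_trans (gc y) xy.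
- exists (set_val x ^+ 2 / 2); first by rewrite divr_gt0 // exprn_even_gt0.
  move=> y xy.
  have /val_inj <- := harmonic_set_isolated (set_valP x) (set_valP y) x0 xy.
  by rewrite subrr normr0.
Qed.

Lemma harmonic_map_continuous : continuous harmonic_map.
Proof. by apply: (@harmonic_continuous _ 3) => // x; exact: harmonic_real_le. Qed.

Lemma harmonic_map_inv_continuous : continuous harmonic_map_inv.
Proof.
apply: (@harmonic_continuous _ 3) => // x.
by rewrite -(normrN (set_val x)) -[in leLHS]normrN opprK; exact: harmonic_real_le.
Qed.

Definition harmonic_homeo : homeomorphism harmonic_space :=
  Homeomorphism harmonic_mapK harmonic_map_invK
    harmonic_map_continuous harmonic_map_inv_continuous.

End Example.

(* Main.v *)
(** Non-shadowing: the odd reciprocals form a single orbit homoclinic to [0].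
    For a finite set of times, running through this orbit twice with a long
    delay is a fine pseudo orbit, but its value is [1] at two different times,
    whereas an orbit takes the value [1] at most once.

    Shadowing with respect to all odd times: if a pseudo orbit is not close to
    the fixed point [0], some [x s] is bounded away from [0]. Then so is its
    image, which is therefore isolated and equal to [x (s + 1)]. Every time
    differs by an odd integer from [s] or from [s + 1], so the orbit through
    [x s] is a trace. *)
Require Import Defs.
From mathcomp Require Import all_boot all_order all_algebra.
From mathcomp Require Import all_classical all_reals all_analysis.
From mathcomp Require Import zify ring lra.

Set Implicit Arguments.
Unset Strict Implicit.
Unset Printing Implicit Defensive.

Import Order.TTheory GRing.Theory Num.Theory.
Import numFieldNormedType.Exports.

Local Open Scope classical_set_scope.
Local Open Scope ring_scope.

Lemma iterz_fixed (X : uniformType) (h : homeomorphism X) (x : X) :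
  h x = x -> forall n, iterz h n x = x.
Proof.
move=> hx; elim/int_ind => [//|n IH|n IH].
- have -> : n.+1%:Z = n%:Z + 1 by lia.
  by rewrite iterzS IH.
- have -> : - n.+1%:Z = - n%:Z - 1 by lia.
  by rewrite iterzP IH -{1}hx homeo_funK.
Qed.

Lemma finite_int_bounded (A : set int) : finite_set A ->
  exists M : nat, forall a, A a -> (`|a| <= M)%N.
Proof.
move=> /finite_seqP[s ->]; exists (\max_(a <- s) `|a|)%N => a /= sa.
exact: (@leq_bigmax_seq _ s xpredT absz).
Qed.

Section Harmonic.
Variable R : realType.
Local Notation X := (harmonic_space R).
Local Notation h := (harmonic_homeo R).

Definition harmonic_zero : X := SigSub (mem_set (or_intror (erefl (0 : R)))).

Lemma harmonic_inv_proof (n : int) : n != 0 -> harmonic_set (n%:~R^-1 : R).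
Proof. by move=> n0; left; exists n. Qed.

Definition harmonic_one : X :=
  SigSub (mem_set (harmonic_inv_proof (oner_neq0 int))).

Lemma iterz_harmonic_zero n : iterz h n harmonic_zero = harmonic_zero.
Proof.
apply: iterz_fixed; apply: val_inj; apply/normr0_eq0/le_anti.
(* The growth bound by [3 * |x|] already forces the value [0] at [0], so oddness need not be
   examined. *)
by rewrite normr_ge0 (le_trans (harmonic_real_le _)) //= normr0 mulr0.
Qed.

Lemma iterz_harmonic_odd (n s : int) (x : X) :
  odd_ints n -> set_val x = n%:~R^-1 ->
  set_val (iterz h s x) = (n - 2 * s)%:~R^-1.
Proof.
move=> [k _ nE] xE; elim/int_ind: s => [|s IH|s IH].
- by rewrite xE mulr0 subr0.
- have -> : s.+1%:Z = s%:Z + 1 by lia.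
  rewrite iterzS; apply: etrans (congr1 (@harmonic_real R) IH) _.
  rewrite harmonic_real_odd; last by exists (k - s%:Z) => //; lia.
  by congr (_%:~R^-1); lia.
- have -> : - s.+1%:Z = - s%:Z - 1 by lia.
  rewrite iterzP.
  apply: etrans (congr1 (fun y : R => - harmonic_real (- y)) IH) _.
  rewrite -invrN -mulrNz harmonic_real_odd; last first.
    by exists (- k - s%:Z - 1) => //; lia.
  by rewrite -invrN -mulrNz; congr (_%:~R^-1); lia.
Qed.

Lemma iterz_harmonic_one s :
  set_val (iterz h s harmonic_one) = (1 - 2 * s)%:~R^-1.
Proof. by apply: iterz_harmonic_odd => //; exists 0. Qed.

Lemma harmonic_one_isolated (x : X) :
  `|set_val harmonic_one - set_val x| < 1 / 2 -> x = harmonic_one.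
Proof.
have v1 : set_val harmonic_one = 1 by exact: invr1.
rewrite v1 => x1; apply/esym/val_inj; apply: (etrans v1).
apply: (harmonic_set_isolated _ (set_valP x)).
- by rewrite -v1; exact: set_valP.
- exact: oner_neq0.
- by rewrite expr1n.
Qed.

(** The denominator satisfies [|1 - 2 * s| >= 2 * |s| - 1 >= |s|], because [s] is nonzero. *)
Lemma iterz_harmonic_one_small (k : nat) (s : int) : (k < `|s|)%N ->
  `|set_val (iterz h s harmonic_one)| <= (k.+1%:R)^-1.
Proof.
move=> ks; rewrite iterz_harmonic_one normfV -intr_norm.
rewrite lef_pV2 ?posrE ?ltr0n ?ltr0z //; last by lia.
by rewrite -[leLHS]/(k.+1%:Z%:~R) ler_int; lia.
Qed.

(** The switch at time [N] is halfway between the two visits to [1], at times [0] and [2 * N], so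
    both copies of the orbit are near [0] there. *)
Definition double_excursion (N : nat) (t : int) : X :=
  iterz h (if t <= N%:Z then t else t - 2 * N%:Z) harmonic_one.

Lemma double_excursion_pseudo_orbit (A : set int)
    (beta : set (X * X)) : finite_set A -> entourage beta ->
  exists2 N : nat, (0 < N)%N &
    pseudo_orbit (iterate_action h) beta A (double_excursion N).
Proof.
move=> /finite_int_bounded[M AM] /harmonic_entourageE[e e0 eb].
have [k ke] : exists k : nat, 2 * (k.+1%:R)^-1 < e.
  exists (Num.bound (2 / e)).
  rewrite ltr_pdivrMr ?ltr0n // mulrC -ltr_pdivrMr //.
  apply: lt_le_trans (archi_boundP _) _; first by rewrite divr_ge0 // ltW.
  by rewrite ler_nat.
(* A step of [A] has size at most [M], so if it crosses the switch at [N], both exponents still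
   exceed [k] in absolute value. *)
exists (M + k).+1 => // a t Aa; apply: eb => /=.
have aM := AM _ Aa.
rewrite /double_excursion -iterzD.
set u := a + (if _ then _ else _); set v := (if a + t <= _ then _ else _).
(* The exponents differ only if [t] and [a + t] lie on opposite sides of the switch; then both
   points are within [1 / (k + 1)] of [0]. *)
have [->|uv] := eqVneq u v; first by rewrite subrr normr0.
have [ku kv] : (k < `|u|)%N /\ (k < `|v|)%N.
  by move: uv; rewrite /u /v; do 2 case: ifP; lia.
have := iterz_harmonic_one_small ku; have := iterz_harmonic_one_small kv.
move=> hv hu; apply: le_lt_trans ke.
by rewrite mulr_natl mulr2n (le_trans (ler_normB _ _)) // lerD.
Qed.

Lemma harmonic_not_shadowing : ~ shadowing (iterate_action h).
Proof.
move=> [A [_ Afin]] /(_ [set xy | `|set_val xy.1 - set_val xy.2| < 1 / 2]).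
case; first by apply/harmonic_entourageE; exists (1 / 2) => //; lra.
move=> beta /(double_excursion_pseudo_orbit Afin)[N N0 po] /(_ _ po)[z tz].
have: `|set_val z - set_val harmonic_one| < 1 / 2 := tz 0.
rewrite distrC => /harmonic_one_isolated zE.
(* As [N > 0], time [2 * N] falls in the delayed copy, where the exponent is [0]. *)
have: `|set_val (iterz h (2 * N%:Z) z) - set_val harmonic_one| < 1 / 2.
  by have := tz (2 * N%:Z); rewrite /double_excursion ifF ?subrr //; lia.
rewrite distrC => /harmonic_one_isolated/(congr1 (@set_val _ _)).
by rewrite zE iterz_harmonic_one => /invr_inj/intr_inj; lia.
Qed.

Lemma harmonic_shadowing_odd : shadowing_wrt (iterate_action h) odd_ints.
Proof.
move=> alpha /harmonic_entourageE[e e0 ea].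
(* The second bound is the isolation radius [y ^ 2 / 2] at [|y| = e / 3], a lower bound for the
   image of a point of absolute value at least [e]. *)
pose d := Num.min e ((e / 3) ^+ 2 / 2).
have d0 : 0 < d by rewrite lt_min e0 divr_gt0 // exprn_gt0 // divr_gt0.
exists [set xy | `|set_val xy.1 - set_val xy.2| < d].
  by apply/harmonic_entourageE; exists d.
move=> x po.
have [xsmall|] := pselect (forall t, `|set_val (x t)| < e).
  exists harmonic_zero => t; apply: ea => /=.
  by rewrite iterz_harmonic_zero sub0r normrN.
move=> /existsNP[s /negP]; rewrite -leNgt => xs.
have xS : x (s + 1) = h (x s).
  have hxs : e / 3 <= `|set_val (h (x s))|.
    (* The inverse is [harmonic_real] conjugated by negation, so it too enlarges absolute values at
       most threefold. *)
    have : `|set_val (x s)| <= 3 * `|set_val (h (x s))|.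
      rewrite -{1}(homeo_funK h (x s)) /= normrN (le_trans (harmonic_real_le _)) //.
      by rewrite normrN.
    lra.
  apply/esym/val_inj; apply: (harmonic_set_isolated (set_valP _) (set_valP _)).
  - by rewrite -normr_gt0 (lt_le_trans _ hxs) // divr_gt0.
  - have /(po 1 s)/= : odd_ints 1 by exists 0.
    rewrite addrC => /lt_le_trans; apply.
    rewrite /d ge_min; apply/orP; right.
    rewrite ler_pM2r ?invr_gt0 // -[leRHS]real_normK ?num_real //.
    by rewrite lerXn2r // nnegrE divr_ge0 // ltW.
(* The shift by [- s] makes this orbit pass through [x s] at time [s]. *)
exists (iterz h (- s) (x s)) => t; apply: ea => /=; rewrite -iterzD.
apply: (@lt_le_trans _ _ d); last by rewrite /d ge_min lexx.
have [k [tE|tE]] : exists k : int, t = 2 * k + 1 + s \/ t = 2 * k + 1 + (s + 1).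
- exists (if odd `|t - s| then ((t - s - 1) %/ 2)%Z else ((t - s - 2) %/ 2)%Z).
  by case: ifP; lia.
- have /(po _ s)/= : odd_ints (2 * k + 1) by exists k.
  by rewrite -tE; have -> : 2 * k + 1 = t - s by lia.
- have /(po _ (s + 1))/= : odd_ints (2 * k + 1) by exists k.
  rewrite -tE xS -[h (x s)]/(iterz h 1 (x s)) -iterzD.
  by have -> : 2 * k + 1 + 1 = t - s by lia.
Qed.

End Harmonic.

Theorem mainTheorem3 (R : realType) :
  ~ shadowing (iterate_action (harmonic_homeo R)) /\
  ideal_shadowing (iterate_action (harmonic_homeo R)) (powerset_ideal odd_ints).
Proof.
split; first exact: harmonic_not_shadowing.
exists odd_ints; split; first by exists 1; exists 0.
- exact: subset_refl.
- exact: harmonic_shadowing_odd.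
Qed.
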